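(* Let $\mathcal{A}$ be a zero product determined Banach algebra with a bounded approximate identity, let $\mathcal{M}$ be a Banach $\mathcal{A}$-bimodule, and let $\delta:\mathcal{A}\to\mathcal{M}$ be a bounded derivation. Then the graph $\mathcal{G}=\{(a,\delta(a)):a\in\mathcal{A}\}$ is a zero product determined Banach algebra.
   Context: A derivation $\delta:\mathcal{A}\to\mathcal{M}$ is a linear map with $\delta(xy)=\delta(x)\cdot y+x\cdot\delta(y)$ for all $x,y\in\mathcal{A}$. The graph $\mathcal{G}$ is equipped with the norm $\|(a,\delta(a))\|_1=\|a\|_{\mathcal{A}}+\|\delta(a)\|_{\mathcal{M}}$ and the operations $(a,\delta(a))+(b,\delta(b))=(a+b,\delta(a+b))$, $(a,\delta(a))(b,\delta(b))=(ab,\delta(a)b+a\delta(b))=(ab,\delta(ab))$. A Banach algebra $\mathcal{A}$ is zero product determined if for every continuous bilinear functional $\psi:\mathcal{A}\times\mathcal{A}\to\mathbb{C}$ such that $\psi(x,y)=0$ whenever $xy=0$, there is a continuous linear functional $\tau$ on $\mathcal{A}$ with $\psi(x,y)=\tau(xy)$ for all $x,y\in\mathcal{A}$. *)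

(* Defs.v *)
From HB Require Import structures.
From mathcomp Require Import all_boot all_order all_algebra sesquilinear.
From mathcomp Require Import complex.
From mathcomp Require Import all_classical all_reals all_analysis.

Set Implicit Arguments.
Unset Strict Implicit.
Unset Printing Implicit Defensive.

Import Order.TTheory GRing.Theory Num.Theory numFieldNormedType.Exports.

Local Open Scope classical_set_scope.
Local Open Scope ring_scope.
Local Open Scope complex_scope.

(* The scalars are R[i], R : realType.  Norms take values in R[i]; since
   x <= y in R[i] forces y - x to be a nonnegative real, norms are nonnegative
   reals and bounds between them are the usual real ones.  Algebras need not be
   unital, so the product is an explicit operation on a normed space. *)

(* [complete_space V] is what a completeNormedModType adds to V; it is a
   predicate so that it can also occur in a conclusion. *)
Definition complete_space (R : realType) (V : normedModType R[i]) : Prop :=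
  forall F : set_system V, ProperFilter F -> cauchy F -> cvg F.

Record is_banach_algebra (R : realType) (A : normedModType R[i])
    (mul : A -> A -> A) : Prop := IsBanachAlgebra {
  banach_algebra_complete : complete_space A;
  banach_algebra_bilinear : bilinear_for *:%R *:%R mul;
  banach_algebra_mulA : associative mul;
  banach_algebra_norm : forall x y, `|mul x y| <= `|x| * `|y|
}.

Record is_banach_bimodule (R : realType) (A : normedModType R[i])
    (mul : A -> A -> A) (M : normedModType R[i])
    (lact : A -> M -> M) (ract : M -> A -> M) : Prop := IsBanachBimodule {
  bimodule_complete : complete_space M;
  bimodule_lact_bilinear : bilinear_for *:%R *:%R lact;
  bimodule_ract_bilinear : bilinear_for *:%R *:%R ract;
  bimodule_lactA : forall a b m, lact (mul a b) m = lact a (lact b m);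
  bimodule_ractA : forall m a b, ract m (mul a b) = ract (ract m a) b;
  bimodule_lractA : forall a m b, ract (lact a m) b = lact a (ract m b);
  bimodule_lact_norm : forall a m, `|lact a m| <= `|a| * `|m|;
  bimodule_ract_norm : forall m a, `|ract m a| <= `|m| * `|a|
}.

(* The filter of tails of a net indexed by (I, le). *)
Definition tails (I : Type) (le : I -> I -> Prop) : set_system I :=
  filter_from setT (fun i => [set j | le i j]).

Definition is_directed (I : Type) (le : I -> I -> Prop) : Prop :=
  [/\ inhabited I,
      forall i, le i i,
      forall i j k, le i j -> le j k -> le i k &
      forall i j, exists k, le i k /\ le j k].

Definition has_bounded_approximate_identity (R : realType)
    (A : normedModType R[i]) (mul : A -> A -> A) : Prop :=
  exists (I : Type) (le : I -> I -> Prop) (e : I -> A),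
    [/\ is_directed le,
        exists k : R, forall i, `|e i| <= k%:C,
        forall a, mul (e i) a @[i --> tails le] --> a &
        forall a, mul a (e i) @[i --> tails le] --> a].

(* R[i]^o is R[i] as a normed space over itself. *)
Definition zero_product_determined (R : realType) (A : normedModType R[i])
    (mul : A -> A -> A) : Prop :=
  forall psi : {bilinear A -> A -> R[i] | *%R & *%R},
    continuous (fun p : A * A => psi p.1 p.2 : R[i]^o) ->
    (forall x y, mul x y = 0 -> psi x y = 0) ->
  exists2 tau : {scalar A}, continuous (tau : A -> R[i]^o) &
    forall x y, psi x y = tau (mul x y).

Definition is_derivation (R : realType) (A : normedModType R[i])
    (mul : A -> A -> A) (M : normedModType R[i])
    (lact : A -> M -> M) (ract : M -> A -> M) (delta : A -> M) : Prop :=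
  forall x y, delta (mul x y) = ract (delta x) y + lact x (delta y).

Definition bounded_operator (R : realType) (V W : normedModType R[i])
    (f : V -> W) : Prop :=
  exists k : R, forall x, `|f x| <= k%:C * `|x|.

Section Graph.
Variables (R : realType) (A M : normedModType R[i]) (delta : {linear A -> M}).

Definition graph_pred : {pred A * M} := fun p => p.2 == delta p.1.

Fact graph_submod_closed : submod_closed graph_pred.
Proof.
split=> [|k p q]; rewrite !unfold_in /= ?linear0 //.
by move=> /eqP -> /eqP ->; rewrite linearP.
Qed.

HB.instance Definition _ :=
  GRing.isSubmodClosed.Build R[i] (A * M)%type graph_pred graph_submod_closed.

Record graph : Type := Graph {
  graph_val :> A * M;
  graph_valP : graph_val \in graph_pred
}.

HB.instance Definition _ := [isSub for graph_val].
HB.instance Definition _ := [Choice of graph by <:].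
HB.instance Definition _ := [SubChoice_isSubLmodule of graph by <:].

(* The library's norm on A * M is the maximum of the norms; the graph carries
   their sum, and the topology of that norm. *)
Definition graph_norm (x : graph) : R[i] :=
  `|(graph_val x).1| + `|(graph_val x).2|.

Fact graph_norm_triangle (x y : graph) :
  graph_norm (x + y) <= graph_norm x + graph_norm y.
Proof. by rewrite /graph_norm /= addrACA lerD // ler_normD. Qed.

Fact graph_normZ (k : R[i]) (x : graph) :
  graph_norm (k *: x) = `|k| * graph_norm x.
Proof. by rewrite /graph_norm /= !normrZ mulrDr. Qed.

Fact graph_norm0_eq0 (x : graph) : graph_norm x = 0 -> x = 0.
Proof.
move=> /eqP; rewrite /graph_norm paddr_eq0 // !normr_eq0 => /andP[/eqP x1 /eqP x2].
by apply: val_inj; rewrite /= [LHS]surjective_pairing x1 x2.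
Qed.

HB.instance Definition _ := Lmodule_isNormed.Build R[i] graph
  graph_norm_triangle graph_normZ graph_norm0_eq0.

Variables (mul : A -> A -> A) (lact : A -> M -> M) (ract : M -> A -> M).
Hypothesis delta_der : is_derivation mul lact ract delta.

Fact graph_mul_subproof (x y : graph) :
  (mul x.1 y.1, ract x.2 y.1 + lact x.1 y.2) \in graph_pred.
Proof.
have /eqP hx := graph_valP x; have /eqP hy := graph_valP y.
by rewrite unfold_in /= hx hy delta_der.
Qed.

Definition graph_mul (x y : graph) : graph := Graph (graph_mul_subproof x y).

End Graph.

(* Main.v *)
Require Import Defs.
From HB Require Import structures.
From mathcomp Require Import all_boot all_order all_algebra sesquilinear.
From mathcomp Require Import complex.
From mathcomp Require Import all_classical all_reals all_analysis.

Import Order.TTheory GRing.Theory Num.Theory numFieldNormedType.Exports.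

Local Open Scope ring_scope.
Local Open Scope complex_scope.

(** The map [a |-> (a, delta a)] is an isomorphism of [A] onto the graph: the
    Leibniz rule is exactly what makes it multiplicative, its inverse is the
    first projection, and it is bounded in both directions, since
    [`|a| <= `|a| + `|delta a| <= (1 + k) * `|a|] when [delta] is bounded by
    [k].  Completeness and zero product determination are both invariant under
    such an isomorphism ([complete_space_transport],
    [zero_product_determined_transport]), so the graph inherits them from [A].
    A point of the graph is determined by its first coordinate, so bilinearity
    and associativity of the product need only be checked in [A].  The sum norm
    is submultiplicative because
    [`|a b| + `|delta a b + a delta b|] is at most
    [`|a| * `|b| + `|delta a| * `|b| + `|a| * `|delta b|], which is the product
    of the norms without the nonnegative term [`|delta a| * `|delta b|]. *)

(** The real constant in [bounded_operator] may be zero or negative; the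
    estimate on Cauchy filters divides by it. *)
Lemma bounded_operator_pos (R : realType) (V W : normedModType R[i])
    (f : V -> W) : bounded_operator f ->
  exists2 k : R[i], 0 < k & forall x, `|f x| <= k * `|x|.
Proof.
move=> [k fk]; exists (`|k%:C| + 1) => [|x].
  by rewrite ltr_wpDl.
apply: le_trans (fk x) _; apply: ler_wpM2r => //.
have kR : k%:C \is Num.real by rewrite complex_real.
by rewrite (le_trans (real_ler_norm kR))// lerDl.
Qed.

Lemma bounded_operator_continuous (R : realType) (V W : normedModType R[i])
    (f : {linear V -> W}) : bounded_operator f -> continuous f.
Proof.
move=> /bounded_operator_pos[k k0 fk]; apply: bounded_linear_continuous.
apply/linear_boundedP; exists k; split; first exact: gtr0_real.
by move=> r kr x; rewrite (le_trans (fk x))// ler_wpM2r// ltW.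
Qed.

Lemma bounded_operator_cauchy (R : realType) (V W : normedModType R[i])
    (f : {linear V -> W}) (F : set_system V) (FF : ProperFilter F) :
  bounded_operator f -> cauchy F -> cauchy (f @ F)%classic.
Proof.
move=> /bounded_operator_pos[k k0 fk] Fc; apply/cauchyP => e e0.
have /cauchyP/(_ (e / k))[|x Fx] := Fc; first by rewrite divr_gt0.
exists (f x); apply: (@filterS _ F _ (ball x (e / k))) => // y.
rewrite /= -!ball_normE /= -linearB => xy.
by rewrite (le_lt_trans (fk _))// mulrC -ltr_pdivlMr.
Qed.

(** A Cauchy filter [F] on [W] is the image under [f] of [g @ F], which is Cauchy
    because [g] is bounded and so converges in [V]; continuity of [f] carries
    its limit to a limit of [F]. *)
Lemma complete_space_transport (R : realType) (V W : normedModType R[i])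
    (f : {linear V -> W}) (g : {linear W -> V}) :
    bounded_operator f -> bounded_operator g -> cancel g f ->
  complete_space V -> complete_space W.
Proof.
move=> fb gb gK cV F FF /(bounded_operator_cauchy _ _ _ g _ _ gb) /cV gF.
apply/cvg_ex; exists (f (lim (g @ F)%classic)).
have fc : continuous f by exact: bounded_operator_continuous.
have := continuous_cvg _ (fc _) gF => /(_ _).
apply: cvg_trans => P FP.
by apply: (@filterS _ F _ _ _ _ FP) => x /=; rewrite gK.
Qed.

Section BilinearPullback.
Variables (R : realType) (V W : lmodType R[i]) (f : {linear V -> W}).
Variable psi : {bilinear W -> W -> R[i] | *%R & *%R}.

Definition bilinear_pullback (x y : V) : R[i] := psi (f x) (f y).

Fact bilinear_pullback_bilinear :
  bilinear_for *%R *%R bilinear_pullback.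
Proof.
by split=> u a x y; rewrite /bilinear_pullback linearP
  ?linearPl ?linearPr.
Qed.

HB.instance Definition _ := bilinear_isBilinear.Build R[i] V V R[i]
  *%R *%R bilinear_pullback bilinear_pullback_bilinear.

End BilinearPullback.

(** The pullback of a form [psi] along [f] vanishes on zero products because [f]
    is multiplicative; if [tau] represents this pullback, then [tau \o g]
    represents [psi], because [g] is multiplicative. *)
Lemma zero_product_determined_transport (R : realType)
    (A B : normedModType R[i]) (mulA : A -> A -> A) (mulB : B -> B -> B)
    (f : {linear A -> B}) (g : {linear B -> A}) :
    continuous f -> continuous g -> cancel g f ->
    {morph f : x y / mulA x y >-> mulB x y} ->
    {morph g : x y / mulB x y >-> mulA x y} ->
  zero_product_determined mulA -> zero_product_determined mulB.
Proof.
move=> fc gc gK fM gM zpdA psi psic psi0.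
have [||tau tauc tauE] := zpdA (bilinear_pullback _ _ _ f psi).
- move=> p; apply: (@continuous_comp _ _ _
    (fun p : A * A => (f p.1, f p.2)) (fun q : B * B => psi q.1 q.2 : R[i]^o));
    last exact: psic.
  by apply: cvg_pair; apply: continuous_comp => //;
    [exact: cvg_fst|exact: fc|exact: cvg_snd|exact: fc].
- by move=> x y xy0; apply: psi0; rewrite -fM xy0 linear0.
exists (tau \o g : {scalar B}) => [x|x y].
  by apply: continuous_comp; [exact: gc|exact: tauc].
by rewrite /= gM -tauE /= /bilinear_pullback !gK.
Qed.

Section GraphIsomorphism.
Variables (R : realType) (A M : normedModType R[i]) (delta : {linear A -> M}).
Local Notation G := (graph delta).

Lemma graph_norm_def (x : G) : `|x| = `|x.1| + `|x.2|.
Proof. by []. Qed.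

Lemma graph_snd (x : G) : x.2 = delta x.1.
Proof. exact/eqP/(graph_valP x). Qed.

Lemma graph_inj (x y : G) : x.1 = y.1 -> x = y.
Proof.
move=> xy; apply: val_inj; rewrite /= [LHS]surjective_pairing.
by rewrite [RHS]surjective_pairing !graph_snd xy.
Qed.

Definition graph_fst (x : G) : A := x.1.

Fact graph_fst_linear : linear graph_fst.
Proof. by []. Qed.

HB.instance Definition _ :=
  GRing.isLinear.Build R[i] G A *:%R graph_fst graph_fst_linear.

Fact graph_lift_subproof (a : A) : (a, delta a) \in graph_pred delta.
Proof. exact: eqxx. Qed.

Definition graph_lift (a : A) : G := Graph (graph_lift_subproof a).

Fact graph_lift_linear : linear graph_lift.
Proof. by move=> k a b; apply: graph_inj. Qed.

HB.instance Definition _ :=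
  GRing.isLinear.Build R[i] A G *:%R graph_lift graph_lift_linear.

Lemma graph_fstK : cancel graph_fst graph_lift.
Proof. by move=> x; apply: graph_inj. Qed.

Lemma graph_fst_bounded : bounded_operator graph_fst.
Proof. by exists 1 => x; rewrite mul1r graph_norm_def lerDl. Qed.

Lemma graph_lift_bounded :
  bounded_operator delta -> bounded_operator graph_lift.
Proof.
move=> [k dk]; exists (1 + k) => a.
by rewrite graph_norm_def /= rmorphD rmorph1 mulrDl mul1r lerD2l.
Qed.

End GraphIsomorphism.

Theorem proposition3 (R : realType)
    (A : normedModType R[i]) (mul : A -> A -> A)
    (A_banach : is_banach_algebra mul)
    (A_zpd : zero_product_determined mul)
    (A_bai : has_bounded_approximate_identity mul)
    (M : normedModType R[i]) (lact : A -> M -> M) (ract : M -> A -> M)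
    (M_bimod : is_banach_bimodule mul lact ract)
    (delta : {linear A -> M})
    (delta_der : is_derivation mul lact ract delta)
    (delta_bounded : bounded_operator delta) :
  is_banach_algebra (graph_mul delta_der) /\
  zero_product_determined (graph_mul delta_der).
Proof.
have lift_bounded := graph_lift_bounded _ _ _ _ delta_bounded.
have fst_bounded := graph_fst_bounded _ _ _ delta.
have fstK := graph_fstK _ _ _ delta.
split; last first.
  apply: (zero_product_determined_transport _ _ _ _ _
    (graph_lift _ _ _ delta) (graph_fst _ _ _ delta)) A_zpd => //.
  - exact: bounded_operator_continuous.
  - exact: bounded_operator_continuous.
  - by move=> a b; apply: graph_inj.
have [Ac [mulPl mulPr] mulA mul_norm] := A_banach.
have [_ _ _ _ _ _ lact_norm ract_norm] := M_bimod.
split.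
- exact: complete_space_transport lift_bounded fst_bounded fstK Ac.
- by split=> z k x y; apply: graph_inj; [exact: mulPl|exact: mulPr].
- by move=> x y z; apply: graph_inj; exact: mulA.
- move=> x y; rewrite !graph_norm_def /=.
  have mul_le := mul_norm x.1 y.1.
  have act_le : `|ract x.2 y.1 + lact x.1 y.2|
      <= `|x.2| * `|y.1| + `|x.1| * `|y.2|.
    by rewrite (le_trans (ler_normD _ _))// lerD.
  rewrite (le_trans (lerD mul_le act_le))//.
  rewrite mulrDl !mulrDr -!addrA lerD2l addrCA !lerD2l.
  by rewrite lerDl mulr_ge0.
Qed.
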